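(* Let $(X_t)_{t\ge0}$ be a one-dimensional Lévy process, and let $$A:=\left\{\beta\in\mathbb{R}\ \middle|\ \mathbb{E}\left[e^{\beta X_t}\right]=1\right\},$$ where $t>0$ is fixed (the set $A$ does not depend on the choice of $t>0$). If the set $A\setminus\{0\}$ is not empty, then $(X_t)_{t\ge0}$ is transient.
   Context: A one-dimensional Lévy process is a real-valued process with $X_0=0$, stationary and independent increments, and càdlàg paths. Transient means $\lim_{t\to\infty}|X_t|=\infty$ almost surely. (Every Lévy process is either transient or recurrent.)
   Formalization: The transience claim assumes in addition that the Lévy process is not almost surely identically zero; for the zero process A is all of ℝ, yet the process is not transient, so the claim as worded fails there. *)

(* Defs.v *)
(* MathComp / MathComp-Analysis development. *)
From mathcomp Require Import all_boot all_order all_algebra.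
From mathcomp Require Import all_classical all_reals all_analysis.
Import Order.TTheory GRing.Theory Num.Theory.
Import numFieldNormedType.Exports.

Set Implicit Arguments.
Unset Strict Implicit.
Unset Printing Implicit Defensive.

Local Open Scope classical_set_scope.
Local Open Scope ring_scope.

(* The product rule is required only for the full family: taking some of the
   [B i] to be [setT] gives it for every subfamily. *)
Definition mutually_independent (d : measure_display) (T : measurableType d)
    (R : realType) (P : probability T R) (n : nat)
    (Y : 'I_n -> T -> R) : Prop :=
  forall B : 'I_n -> set R, (forall i, measurable (B i)) ->
    P (\bigcap_(i in [set: 'I_n]) (Y i @^-1` B i)) =
    (\prod_(i < n) P (Y i @^-1` B i))%E.

(* Processes are indexed by [R], but the time set is [0, +oo[: the values at
   negative times are junk random variables that nothing below uses. *)
Section process.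
Context (d : measure_display) (T : measurableType d) (R : realType)
  (P : probability T R).
Implicit Type X : R -> {RV P >-> R}.

(* A finite grid 0 <= t_0 <= ... <= t_n is given as the beginning of a
   nondecreasing sequence. *)
Definition independent_increments X : Prop :=
  forall (n : nat) (t : nat -> R), 0 <= t 0%N -> nondecreasing_seq t ->
    mutually_independent P (fun i : 'I_n => X (t i.+1) \- X (t i)).

(* [X h] stands for [X h - X 0]; the two agree in a Lévy process. *)
Definition stationary_increments X : Prop :=
  forall s h : R, 0 <= s -> 0 <= h ->
    forall B : set R, measurable B ->
      P ((X (s + h) \- X s) @^-1` B) = P (X h @^-1` B).

Definition cadlag (x : R -> R) : Prop :=
  (forall t, 0 <= t -> x s @[s --> t^'+] --> x t) /\
  (forall t, 0 < t -> cvg (x s @[s --> t^'-])).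

Definition levy_process X : Prop :=
  [/\ forall w, X 0 w = 0,
      independent_increments X,
      stationary_increments X &
      forall w, cadlag (fun t => X t w)].

Definition transient X : Prop :=
  {ae P, forall w, `|X t w| @[t --> +oo] --> +oo}.

Definition zero_process X : Prop :=
  {ae P, forall w, forall t, 0 <= t -> X t w = 0}.

(* The integrand is nonnegative, so the expectation is always meaningful, with
   value [+oo] allowed. *)
Definition unit_exponents X (t : R) : set R :=
  [set beta | ('E_P[fun w => expR (beta * X t w)] = 1)%E].

End process.

(* Main.v *)
(* For [b <> 0] with [E exp(b X_t) = 1], the identity persists at rational
   multiples of [t] by multiplicativity of [s |-> E exp(b X_s)]; Fatou and right
   continuity give [E exp(b X_s) <= 1] for all [s], and multiplicativity turns
   this into an equality, whence the first claim. For the second one, put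
   [N_s = exp(b X_s / 2)]. Then [E N_s <= 1], with equality only if [X_s = 0]
   almost surely, so some [h] has [r = E N_h < 1], unless [X] is the zero
   process. The maximal inequality for the nonnegative supermartingale [N] gives
   [P(sup_(s >= n h) N_s > l) <= r^n / l], hence [N_s -> 0] almost surely, that
   is, [b X_s -> -oo]. *)
From HB Require Import structures.
Require Import Defs.
From mathcomp Require Import all_boot all_order all_algebra.
From mathcomp Require Import all_classical all_reals all_analysis.
From mathcomp Require Import measurable_realfun ring lra.
Import Order.TTheory GRing.Theory Num.Theory.
Import numFieldNormedType.Exports.
Set Implicit Arguments.
Unset Strict Implicit.
Unset Printing Implicit Defensive.
Local Open Scope classical_set_scope.
Local Open Scope ring_scope.

(** * Product rules for independent real random variables *)

Section independence.
Context (d : measure_display) (T : measurableType d) (R : realType)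
  (P : probability T R).
Implicit Types U V : T -> R.

(** The law of [(U, V)] and the product of the two laws agree on rectangles, hence everywhere, and
    Tonelli splits the integral, infinite values included. *)
Lemma integral_mul_indep U V :
  measurable_fun setT U -> measurable_fun setT V ->
  (forall w, 0 <= U w) -> (forall w, 0 <= V w) ->
  (forall A B : set R, measurable A -> measurable B ->
    P (U @^-1` A `&` V @^-1` B) = (P (U @^-1` A) * P (V @^-1` B))%E) ->
  (\int[P]_w (U w * V w)%:E = (\int[P]_w (U w)%:E) * (\int[P]_w (V w)%:E))%E.
Proof.
move=> mU mV U0 V0 indUV.
pose U' : {mfun T >-> R} := HB.pack U (isMeasurableFun.Build _ _ _ _ U mU).
pose V' : {mfun T >-> R} := HB.pack V (isMeasurableFun.Build _ _ _ _ V mV).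
have mW : measurable_fun setT (fun w => (U w, V w)).
  exact/measurable_fun_pair.
pose W : {mfun T >-> (R * R)%type} :=
  HB.pack (fun w => (U w, V w)) (isMeasurableFun.Build _ _ _ _ _ mW).
(* The absolute values make [f] nonnegative on the whole plane, as Tonelli requires; they change
   nothing on the range of [W]. *)
pose f (x : R * R) : \bar R := (`|x.1| * `|x.2|)%:E.
have mf : measurable_fun [set: R * R] f.
  apply/measurable_EFinP/measurable_funM; apply: measurableT_comp => //.
have mabs : measurable_fun [set: R] (fun x : R => `|x|%:E).
  by apply/measurable_EFinP; exact: normr_measurable.
have f0 x : (0 <= f x)%E by rewrite lee_fin mulr_ge0.
have lawW C : measurable C ->
    (distribution P U' \x distribution P V')%E C = distribution P W C.
  by apply: product_measure_unique => A B mA mB; exact: indUV.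
transitivity (\int[distribution P W]_x f x)%E.
  rewrite ge0_integral_distribution//; apply: eq_integral => w _ /=.
  by rewrite /f /= !ger0_norm.
transitivity (\int[(distribution P U' \x distribution P V')%E]_x f x)%E.
  by apply: eq_measure_integral => C mC _; exact/esym/lawW.
rewrite fubini_tonelli1//.
transitivity (\int[distribution P U']_x (`|x|%:E * \int[P]_w (V w)%:E))%E.
  apply: eq_integral => x _; rewrite /fubini_F /f /=.
  under eq_integral do rewrite EFinM.
  rewrite ge0_integralZl// ge0_integral_distribution//.
  by congr (_ * _)%E; apply: eq_integral => w _ /=; rewrite ger0_norm.
rewrite ge0_integralZr//; last by apply: integral_ge0 => w _; rewrite lee_fin.
rewrite ge0_integral_distribution//.
by congr (_ * _)%E; apply: eq_integral => w _ /=; rewrite ger0_norm.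
Qed.

(** Dynkin's argument: rectangles form a generating pi-system, and the sets [C] satisfying the
    product rule are closed under complements and countable disjoint unions. *)
Lemma indep_pair_event U V (F : set T) :
  measurable_fun setT U -> measurable_fun setT V -> measurable F ->
  (forall A B : set R, measurable A -> measurable B ->
    P (U @^-1` A `&` V @^-1` B `&` F) = (P (U @^-1` A `&` V @^-1` B) * P F)%E) ->
  forall C : set (R * R), measurable C ->
    P ((fun w => (U w, V w)) @^-1` C `&` F) =
    (P ((fun w => (U w, V w)) @^-1` C) * P F)%E.
Proof.
move=> mU mV mF indF C mC.
have mW : measurable_fun setT (fun w => (U w, V w)).
  exact/measurable_fun_pair.
set W := fun w => (U w, V w) in mW *.
have mWE D : measurable D -> measurable (W @^-1` D).
  by move=> mD; rewrite -[X in measurable X]setTI; exact: mW.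
move: C mC; rewrite measurable_prod_measurableType.
apply: (dynkin_induction (measurable_prod_measurableType _ _)).
- move=> _ _ [A1 mA1 [B1 mB1 <-]] [A2 mA2 [B2 mB2 <-]].
  exists (A1 `&` A2); first exact: measurableI.
  exists (B1 `&` B2); first exact: measurableI.
  by rewrite setXI.
- by rewrite preimage_setT setTI probability_setT mul1e.
- by move=> _ [A mA [B mB <-]]; exact: indF.
- move=> D mD PD; have mWD := mWE _ mD.
  have PD' : P (~` (W @^-1` D) `&` F) = (P F - P (W @^-1` D `&` F))%E.
    rewrite setIC -setDE measureD// 1?setIC//.
    by rewrite ltey_eq fin_num_measure.
  rewrite preimage_setC PD' PD probability_setC//.
  have PF : P F \is a fin_num by exact: fin_num_measure.
  have PW : P (W @^-1` D) \is a fin_num by exact: fin_num_measure.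
  by rewrite muleBl// ?mul1e// fin_num_adde_defl.
- move=> D mD tD PD; rewrite preimage_bigcup setI_bigcupl.
  have tWD : trivIset setT (fun k => W @^-1` D k) 
    by move: tD => /trivIsetP tD; apply/trivIsetP => i j _ _ ij;
      rewrite -preimage_setI (tD i j)// preimage_set0.
  rewrite !measure_bigcup//; last 3 first.
  - by move=> k _; exact: mWE.
  - by move=> k _; apply: measurableI => //; exact: mWE.
  - exact: trivIset_setIr.
  have PF : P F \is a fin_num by exact: fin_num_measure.
  rewrite muleC -(fineK PF) -nneseriesZl//.
  by apply: eq_eseriesr => k _; rewrite fineK// muleC; exact: PD.
Qed.
End independence.

(** * Doob's maximal inequality for products of independent exponentials *)

Section maximal_inequality.
Context (d : measure_display) (T : measurableType d) (R : realType)
  (P : probability T R).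
Variable Y : nat -> T -> R.
Hypothesis mY : forall k, measurable_fun setT (Y k).
Hypothesis indY :
  forall k n, mutually_independent P (fun i : 'I_n => Y (k + i)%N).

Let measurable_preY k (B : set R) : measurable B -> measurable (Y k @^-1` B).
Proof. by move=> mB; rewrite -[X in measurable X]setTI; exact: mY. Qed.

Let measurables (s : seq (set R)) := forall i, measurable (nth setT s i).

(** Constraints on consecutive variables are kept in a list, so that an induction can move one more
    variable into the event by consing. *)
Fixpoint tail_event k (s : seq (set R)) : set T :=
  if s is B :: s' then Y k @^-1` B `&` tail_event k.+1 s' else setT.

Let tail_eventE k s : tail_event k s =
  \bigcap_(i in [set: 'I_(size s)]) (Y (k + i)%N @^-1` nth setT s i).
Proof.
elim: s k => [|B s IHs] k /=; first by apply/seteqP; split => // w _ [].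
rewrite IHs; apply/seteqP; split => [w [Bw sw] i _|w sw]; last first.
  split; first by have := sw ord0 I; rewrite /= addn0.
  by move=> i _; have := sw (lift ord0 i) I; rewrite /= /bump /= add1n addnS.
case: (unliftP ord0 i) => [j ->|->] /=; last by rewrite addn0.
by rewrite /bump /= add1n addnS; exact: sw.
Qed.

Let tail_event_cons k B s : measurables (B :: s) ->
  P (tail_event k (B :: s)) = (P (Y k @^-1` B) * P (tail_event k.+1 s))%E.
Proof.
move=> mBs; rewrite !tail_eventE indY ?indY; last 2 first.
- by move=> i; exact: (mBs i.+1).
- by move=> i; exact: mBs.
rewrite big_ord_recl /= addn0; congr (_ * _)%E.
by apply: eq_bigr => i _; rewrite /= /bump /= add1n addnS.
Qed.

Let measurable_tail_event k s : measurables s -> measurable (tail_event k s).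
Proof.
elim: s k => [|B s IHs] k mBs //=; apply: measurableI.
  by apply: measurable_preY; exact: (mBs 0%N).
by apply: IHs => i; exact: (mBs i.+1).
Qed.

Variable l : R.
Hypothesis l0 : 0 <= l.

Let kill (x : R) : R := if x <= l then x else 0.

Let measurable_kill : measurable_fun [set: R] kill.
Proof.
by apply: measurable_fun_ifT => //; apply: measurable_fun_ler.
Qed.

(* The products of the [expR (Y i)], sent to the cemetery [0] as soon as they
   exceed [l]. *)
Fixpoint killed k (w : T) : R :=
  if k is k'.+1 then kill (killed k' w * expR (Y k w)) else kill (expR (Y 0 w)).

Let measurable_expY k : measurable_fun setT (fun w => expR (Y k w)).
Proof. exact: measurableT_comp. Qed.

Let measurable_killed k : measurable_fun setT (killed k).
Proof.
elim: k => [|k IHk] /=; first exact: measurableT_comp.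
by apply: measurableT_comp => //; exact: measurable_funM.
Qed.

Let measurable_pre_killed k (A : set R) :
  measurable A -> measurable (killed k @^-1` A).
Proof.
by move=> mA; rewrite -[X in measurable X]setTI; exact: measurable_killed.
Qed.

Let measurable_EexpY k : measurable_fun setT (fun w => (expR (Y k w))%:E).
Proof. by apply/measurable_EFinP; exact: measurable_expY. Qed.

Let measurable_Ekilled k : measurable_fun setT (fun w => (killed k w)%:E).
Proof. by apply/measurable_EFinP; exact: measurable_killed. Qed.

Let killed_ge0 k w : 0 <= killed k w.
Proof.
have kill_ge0 x : 0 <= x -> 0 <= kill x by rewrite /kill; case: ifP.
elim: k => [|k IHk] /=; apply: kill_ge0; first exact: expR_ge0.
by rewrite mulr_ge0 ?expR_ge0.
Qed.

(** [killed k] depends only on the variables up to index [k]. The induction sees [killed k.+1] as a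
    function of the pair [(killed k, Y k.+1)], for which rectangles suffice. *)
Let killed_indep_tail k (A : set R) s : measurable A -> measurables s ->
  P (killed k @^-1` A `&` tail_event k.+1 s) =
  (P (killed k @^-1` A) * P (tail_event k.+1 s))%E.
Proof.
elim: k A s => [|k IHk] A s mA ms.
  have mA' : measurable ((kill \o expR) @^-1` A).
    have mk : measurable_fun [set: R] (kill \o expR) by exact: measurableT_comp.
    by rewrite -[X in measurable X]setTI; exact: mk.
  have mAs : measurables ((kill \o expR) @^-1` A :: s) by case.
  exact: (@tail_event_cons 0 _ _ mAs).
have mC : measurable ((fun x : R * R => kill (x.1 * expR x.2)) @^-1` A).
  rewrite -[X in measurable X]setTI.
  have mh : measurable_fun [set: R * R] (fun x : R * R => kill (x.1 * expR x.2)).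
    apply: measurableT_comp => //; apply: measurable_funM => //.
    exact: measurableT_comp.
  exact: mh.
have mF := measurable_tail_event k.+2 ms.
apply: (indep_pair_event (measurable_killed k) (mY k.+1) mF _ mC).
move=> A' B mA' mB.
(* The induction hypothesis is used twice: with [B :: s] it factors the whole event, with [[:: B]]
   it factors the rectangle. *)
have mBs : measurables (B :: s) by case.
have mB0 : measurables [:: B] by case=> //= i; rewrite nth_nil.
have := IHk A' (B :: s) mA' mBs; rewrite tail_event_cons// /= setIA => ->.
by have := IHk A' [:: B] mA' mB0; rewrite /= setIT => ->; rewrite muleA.
Qed.

Let integral_killedM k :
  (\int[P]_w (killed k w * expR (Y k.+1 w))%:E =
   \int[P]_w (killed k w)%:E * \int[P]_w (expR (Y k.+1 w))%:E)%E.
Proof.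
apply: integral_mul_indep => // A B mA mB.
have mB' : measurable (expR @^-1` B).
  by rewrite -[X in measurable X]setTI; exact: measurable_expR.
have := @killed_indep_tail k A [:: expR @^-1` B] mA.
by rewrite /= setIT; apply; case=> //= i; rewrite nth_nil.
Qed.

Hypothesis supY : forall k, (\int[P]_w (expR (Y k.+1 w))%:E <= 1)%E.

(* Its expectation does not increase with [k], which replaces stopping times in
   Doob's argument. *)
Let lyapunov k (w : T) : R := l * \1_(killed k @^-1` [set 0]) w + killed k w.

Let measurable_killed0 k : measurable (killed k @^-1` [set 0]).
Proof. exact: measurable_pre_killed. Qed.

Let integral_lyapunov k :
  (\int[P]_w (lyapunov k w)%:E <= \int[P]_w (expR (Y 0 w))%:E)%E.
Proof.
have mlk j : measurable_fun setT (fun w => l * \1_(killed j @^-1` [set 0]) w).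
  by apply: measurable_funM => //; exact: measurable_indic.
have ly0 j w : (0 <= (lyapunov j w)%:E)%E.
  by rewrite lee_fin addr_ge0 ?mulr_ge0.
elim: k => [|k IHk].
  apply: ge0_le_integral => //.
  - by apply/measurable_EFinP/measurable_funD.
  move=> w _; rewrite lee_fin /lyapunov indicE /= /kill.
  case: (leP (expR (Y 0 w)) l) => [le_l|lt_l].
    by rewrite memNset ?mulr0 ?add0r//= /kill le_l; exact/eqP/lt0r_neq0/expR_gt0.
  by rewrite mem_set ?mulr1 ?addr0 ?ltW//= /kill leNgt lt_l.
apply: le_trans IHk.
(* The intermediate integrand multiplies by the next factor without killing. Killing only replaces a
   value above [l] by the reward [l], which is a pointwise decrease; independence and [supY] then
   remove the factor. *)
apply: (@le_trans _ _ (\int[P]_w ((l * \1_(killed k @^-1` [set 0]) w)%:E +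
    (killed k w * expR (Y k.+1 w))%:E))%E).
  apply: ge0_le_integral => //.
  - by apply/measurable_EFinP/measurable_funD.
  - by apply/measurable_EFinP/measurable_funD => //; exact: measurable_funM.
  move=> w _; rewrite -EFinD lee_fin /lyapunov.
  have [k0|k0] := eqVneq (killed k w) 0.
    (* The cemetery is absorbing. *)
    have k1 : killed k.+1 w = 0 by rewrite /= k0 mul0r /kill l0.
    by rewrite !indicE !mem_set// k1 k0 mul0r.
  rewrite [in leRHS]indicE [in leRHS]memNset; last exact/eqP.
  rewrite mulr0 add0r /= indicE /kill.
  case: (leP (killed k w * expR (Y k.+1 w)) l) => [le_l|lt_l].
    rewrite memNset ?mulr0 ?add0r//= /kill le_l; apply/eqP.
    by rewrite mulf_neq0// gt_eqF// expR_gt0.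
  by rewrite mem_set ?mulr1 ?addr0 ?ltW//= /kill leNgt lt_l.
rewrite ge0_integralD//; first last.
- by apply/measurable_EFinP; exact: measurable_funM.
- by move=> w _; rewrite lee_fin mulr_ge0 ?expR_ge0.
- by apply/measurable_EFinP; exact: mlk.
- by move=> w _; rewrite lee_fin mulr_ge0.
under [in leRHS]eq_integral do rewrite EFinD.
rewrite ge0_integralD//; first last.
- by move=> w _; rewrite lee_fin.
- by apply/measurable_EFinP; exact: mlk.
- by move=> w _; rewrite lee_fin mulr_ge0.
rewrite leeD2l// integral_killedM -[leRHS]mule1 lee_wpmul2l//.
by apply: integral_ge0 => w _; rewrite lee_fin.
Qed.

(** Exponentials are positive, so [0] can only come from killing: a nonzero value certifies that no
    partial product has exceeded [l]. *)
Let killed_neq0 k w : killed k w != 0 ->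
  killed k w = expR (\sum_(i < k.+1) Y i w) /\
  forall j, (j <= k)%N -> expR (\sum_(i < j.+1) Y i w) <= l.
Proof.
elim: k => [|k IHk] /=.
  rewrite /kill; case: leP => [le_l _|_]; last by rewrite eqxx.
  rewrite big_ord1; split => // j; rewrite leqn0 => /eqP ->.
  by rewrite big_ord1.
have [->|/IHk[kE le_l]] := eqVneq (killed k w) 0.
  by rewrite mul0r /kill; case: ifP; rewrite eqxx.
have -> : killed k w * expR (Y k.+1 w) = expR (\sum_(i < k.+2) Y i w).
  by rewrite big_ord_recr expRD kE.
rewrite /kill.
case: ifP => [le_l1 _|_]; last by rewrite eqxx.
split => // j; rewrite leq_eqVlt => /orP[/eqP ->//|]; exact: le_l.
Qed.

(** Where some partial product exceeds [l], [killed k] vanishes and [lyapunov k] is at least [l];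
    Markov's argument concludes. *)
Lemma maximal_inequality k :
  (l%:E * P [set w | exists2 j, (j <= k)%N & (l < expR (\sum_(i < j.+1) Y i w))%R]
   <= \int[P]_w (expR (Y 0 w))%:E)%E.
Proof.
apply: le_trans (integral_lyapunov k).
have sub_killed : [set w | exists2 j, (j <= k)%N &
    l < expR (\sum_(i < j.+1) Y i w)] `<=` killed k @^-1` [set 0].
  move=> w [j jk lj] /=; apply/eqP; apply: contraT => /killed_neq0[_].
  by move=> /(_ _ jk); rewrite leNgt lj.
have mS : measurable [set w | exists2 j, (j <= k)%N &
    l < expR (\sum_(i < j.+1) Y i w)].
  rewrite [X in measurable X](_ : _ = \bigcup_(j in `I_k.+1)
    [set w | l < expR (\sum_(i < j.+1) Y i w)]); last first.
    by apply/seteqP; split => w [j jk lj]; exists j.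
  apply: bigcup_measurable => j _.
  rewrite -[X in measurable X]setTI; apply: measurable_fun_ltr => //.
  by apply: measurableT_comp => //; exact: measurable_sum.
have lePS : (P [set w | exists2 j, (j <= k)%N &
    (l < expR (\sum_(i < j.+1) Y i w))%R] <= P (killed k @^-1` [set 0%R]))%E.
  by apply: le_measure sub_killed; rewrite inE.
apply: (le_trans (lee_wpmul2l _ lePS)); first by rewrite lee_fin.
have <- : (\int[P]_w (\1_(killed k @^-1` [set 0%R]) w)%:E =
    P (killed k @^-1` [set 0%R]))%E by rewrite integral_indic// setIT.
rewrite -ge0_integralZl//; last exact/measurable_EFinP/measurable_indic.
apply: ge0_le_integral => //.
- by move=> w _; rewrite mule_ge0 ?lee_fin.
- by apply: measurable_funeM; exact/measurable_EFinP/measurable_indic.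
- apply/measurable_EFinP/measurable_funD => //.
  by apply: measurable_funM => //; exact: measurable_indic.
by move=> w _; rewrite -EFinM lee_fin lerDl.
Qed.
End maximal_inequality.

(** * Approximation of a time by grid points from the right *)

(** For [0 <= s] and [0 < h], this is the first multiple of [h / n.+1%:R] strictly after [s].
    Strictness matters because right limits ignore the point itself. *)
Definition right_mesh (R : realType) (h s : R) (n : nat) : R :=
  (Num.truncn (s * n.+1%:R / h)).+1%:R * (h / n.+1%:R).

Lemma right_mesh_gt (R : realType) (h s : R) n : 0 < h -> s < right_mesh h s n.
Proof.
move=> h0; have hn0 : 0 < h / n.+1%:R by rewrite divr_gt0.
rewrite -ltr_pdivrMr// invf_div mulrA; exact: truncnS_gt.
Qed.

Lemma right_mesh_le (R : realType) (h s : R) n : 0 < h -> 0 <= s ->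
  right_mesh h s n <= s + h / n.+1%:R.
Proof.
move=> h0 s0; have hn0 : 0 < h / n.+1%:R by rewrite divr_gt0.
rewrite /right_mesh -natr1 mulrDl mul1r lerD2r -ler_pdivlMr// invf_div mulrA.
by rewrite truncn_le !mulr_ge0// invr_ge0 ltW.
Qed.

Lemma cvg_right_mesh (R : realType) (h s : R) : 0 < h -> 0 <= s ->
  right_mesh h s n @[n --> \oo] --> s.
Proof.
move=> h0 s0.
apply: (@squeeze_cvgr _ _ _ _ (cst s) (fun n => s + h * (n.+1%:R)^-1)).
- by near=> n; rewrite ltW ?right_mesh_gt//= right_mesh_le.
- exact: cvg_cst.
- rewrite -[X in _ --> X]addr0 -[X in s + X](mulr0 h).
  apply: cvgD; first exact: cvg_cst.
  by apply: cvgM; [exact: cvg_cst|exact: cvg_harmonic].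
Unshelve. all: by end_near.
Qed.

(** * Exponential moments of a Lévy process *)

Section levy_exponential_moments.
Context (d : measure_display) (T : measurableType d) (R : realType)
  (P : probability T R) (X : R -> {RV P >-> R}).
Hypothesis hX : levy_process X.
Variable g : R.

Definition exp_moment (s : R) : \bar R := (\int[P]_w (expR (g * X s w))%:E)%E.

Let measurable_expX s : measurable_fun setT (fun w => (expR (g * X s w))%:E).
Proof.
by apply/measurable_EFinP; apply: measurableT_comp => //; exact: measurable_funM.
Qed.

Lemma exp_moment_ge0 s : (0 <= exp_moment s)%E.
Proof. by apply: integral_ge0 => w _; rewrite lee_fin expR_ge0. Qed.

Lemma exp_moment0 : exp_moment 0 = 1%E.
Proof.
have [X0 _ _ _] := hX; rewrite /exp_moment.
under eq_integral do rewrite X0 mulr0 expR0.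
by rewrite integral_cst//= probability_setT mule1.
Qed.

Lemma exp_moment_increment s h : 0 <= s -> 0 <= h ->
  (\int[P]_w (expR (g * (X (s + h) w - X s w)))%:E = exp_moment h)%E.
Proof.
move=> s0 h0; have [_ _ statX _] := hX.
pose D : {mfun T >-> R} := X (s + h) \- X s.
pose f (x : R) := (expR (g * x))%:E.
have mf : measurable_fun [set: R] f.
  by apply/measurable_EFinP; apply: measurableT_comp => //; exact: measurable_funM.
have f0 x : (0 <= f x)%E by rewrite lee_fin expR_ge0.
transitivity (\int[distribution P D]_x f x)%E.
  by rewrite ge0_integral_distribution.
transitivity (\int[distribution P (X h)]_x f x)%E.
  by apply: eq_measure_integral => B mB _; exact: statX.
by rewrite ge0_integral_distribution.
Qed.

Lemma levy_indep_shift (t : nat -> R) k n : 0 <= t 0%N -> nondecreasing_seq t ->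
  mutually_independent P (fun i : 'I_n => X (t (k + i).+1) \- X (t (k + i)%N)).
Proof.
move=> t0 ndt; have [_ indX _ _] := hX.
have := indX n (fun i => t (k + i)%N) _ _; rewrite addn0.
have -> : (fun i : 'I_n => X (t (k + i.+1)%N) \- X (t (k + i)%N)) =
    (fun i : 'I_n => X (t (k + i).+1) \- X (t (k + i)%N)).
  by apply/funext => i; rewrite addnS.
apply; first by rewrite (le_trans t0)// ndt.
by move=> i j ij; rewrite ndt// leq_add2l.
Qed.

Lemma exp_momentD s h : 0 <= s -> 0 <= h ->
  (exp_moment (s + h) = exp_moment s * exp_moment h)%E.
Proof.
move=> s0 h0; have [X0 indX _ _] := hX.
(* The grid [0, s, s + h], continued as a constant sequence; its two increments are [X s] and
   [X (s + h) - X s]. *)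
pose t (i : nat) : R := if i is i'.+1 then if i' is 0%N then s else s + h else 0.
have ndt : nondecreasing_seq t.
  by apply/nondecreasing_seqP => -[|[|i]] //=; rewrite lerDl.
rewrite -(exp_moment_increment s0 h0) -integral_mul_indep.
- apply: eq_integral => w _; rewrite -expRD; congr (expR _)%:E; ring.
- by apply: measurableT_comp => //; exact: measurable_funM.
- by apply: measurableT_comp => //; apply: measurable_funM => //; exact: measurable_funB.
- by move=> w; exact: expR_ge0.
- by move=> w; exact: expR_ge0.
move=> A B mA mB.
have mG C : measurable C -> measurable ((fun x : R => expR (g * x)) @^-1` C).
  move=> mC; have mf : measurable_fun [set: R] (fun x : R => expR (g * x)).
    by apply: measurableT_comp => //; exact: measurable_funM.
  by rewrite -[X in measurable X]setTI; exact: mf.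
have := indX 2%N t (lexx _) ndt (fun i => if i == ord0
  then (fun x : R => expR (g * x)) @^-1` A
  else (fun x : R => expR (g * x)) @^-1` B) _.
rewrite big_ord_recl big_ord1 /=.
have -> : \bigcap_(i in [set: 'I_2])
    ((X (t i.+1) \- X (t i)) @^-1` (if i == ord0
      then (fun x : R => expR (g * x)) @^-1` A
      else (fun x : R => expR (g * x)) @^-1` B)) =
   (fun w => expR (g * X s w)) @^-1` A `&`
   (fun w => expR (g * (X (s + h) w - X s w))) @^-1` B.
  apply/seteqP; split => w.
    move=> Hw; split.
      by have := Hw ord0 I; rewrite /= X0 subr0.
    by have := Hw ord_max I.
  move=> [Aw Bw] i _; case: (unliftP ord0 i) => [j ->|->] /=.
    by rewrite (ord1 j).
  by rewrite X0 subr0.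
have -> : (X s \- X 0) @^-1` ((fun x : R => expR (g * x)) @^-1` A) =
  (fun w => expR (g * X s w)) @^-1` A.
  by apply/seteqP; split => w /=; rewrite X0 subr0.
by apply => i; case: ifP => _; exact: mG.
Qed.

Lemma exp_momentMn n s : 0 <= s ->
  (exp_moment (n%:R * s) = exp_moment s ^+ n)%E.
Proof.
move=> s0; elim: n => [|n IHn]; first by rewrite mul0r exp_moment0 expe0.
rewrite -natr1 mulrDl mul1r addrC exp_momentD// ?mulr_ge0// IHn.
by rewrite expeS.
Qed.

Section unit_moment.
Variable t : R.
Hypothesis t0 : 0 < t.
Hypothesis mt1 : exp_moment t = 1%E.

(** The moment at [t / n.+1%:R] is a nonnegative extended real whose power of exponent [n.+1] is
    [1]; this excludes [+oo] and leaves only [1]. *)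
Let exp_moment_mesh j n : exp_moment (j%:R * (t / n.+1%:R)) = 1%E.
Proof.
have tn0 : 0 <= t / n.+1%:R by rewrite divr_ge0// ltW.
rewrite exp_momentMn//.
suff -> : exp_moment (t / n.+1%:R) = 1%E by rewrite -EFin_expe expr1n.
have : (exp_moment (t / n.+1%:R) ^+ n.+1 = 1)%E.
  by rewrite -exp_momentMn// mulrCA divff// mulr1.
move: (exp_moment_ge0 (t / n.+1%:R)).
case: (exp_moment (t / n.+1%:R)) => [r r0||//].
  by rewrite -EFin_expe => -[] /eqP; rewrite pexpr_eq1// => /eqP ->.
have -> : (+oo ^+ n.+1 = +oo :> \bar R)%E.
  by elim: {tn0} n => // n IHn; rewrite expeS IHn mulyy.
by [].
Qed.

(** Fatou along the mesh points decreasing towards [s] in the limit, where all moments equal [1];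
    only an inequality survives. *)
Let exp_moment_le1 s : 0 <= s -> (exp_moment s <= 1)%E.
Proof.
move=> s0; have [_ _ _ rcX] := hX.
have XE w : limn_einf (fun n => (expR (g * X (right_mesh t s n) w))%:E) =
    (expR (g * X s w))%:E.
  have cX : X (right_mesh t s n) w @[n --> \oo] --> X s w.
    have [/(_ s s0)/cvg_at_rightP + _] := rcX w; apply; split.
      by move=> n; exact: right_mesh_gt.
    exact: cvg_right_mesh.
  have cE : (expR (g * X (right_mesh t s n) w))%:E @[n --> \oo] -->
      (expR (g * X s w))%:E.
    apply: cvg_EFin; first by near=> n.
    apply: (@continuous_cvg _ _ _ _ _ (fun n => g * X (right_mesh t s n) w) expR).
      exact: continuous_expR.
    by apply: cvgM => //; exact: cvg_cst.
  by rewrite is_cvg_limn_einfE; [exact/cvg_lim|apply/cvg_ex; eexists; exact: cE].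
rewrite /exp_moment; under eq_integral do rewrite -XE.
apply: le_trans.
  apply: fatou => // n w _; by rewrite lee_fin expR_ge0.
rewrite (_ : (fun n => _) = (fun=> 1%E)); last first.
  by apply/funext => n; exact: exp_moment_mesh.
rewrite is_cvg_limn_einfE; last exact: is_cvg_cst.
by rewrite lim_cst.
Unshelve. all: by end_near.
Qed.

Lemma exp_moment_unit s : 0 <= s -> exp_moment s = 1%E.
Proof.
(* [r] is the gap from [s] to the next multiple of [t], where the moment is [1]. Two factors in
   [[0, 1]] with product [1] are both [1]. *)
move=> s0; pose r := right_mesh t s 0 - s.
have r0 : 0 <= r by rewrite subr_ge0 ltW ?right_mesh_gt.
have : (exp_moment s * exp_moment r = 1)%E.
  by rewrite -exp_momentD// addrC subrK exp_moment_mesh.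
have := exp_moment_le1 s0; have := exp_moment_le1 r0.
have := exp_moment_ge0 s; have := exp_moment_ge0 r.
case: (exp_moment s) => [x||]; case: (exp_moment r) => [y||] //.
rewrite -EFinM !lee_fin => y0 x0 y1 x1 [xy1]; congr (_%:E); nra.
Qed.
End unit_moment.
End levy_exponential_moments.

(** * The maximal inequality in continuous time *)

Section levy_maximal_inequality.
Context (d : measure_display) (T : measurableType d) (R : realType)
  (P : probability T R) (X : R -> {RV P >-> R}).
Hypothesis hX : levy_process X.
Variables (g l : R).
Hypothesis l0 : 0 < l.
Hypothesis moment_le1 : forall s, 0 <= s -> (exp_moment X g s <= 1)%E.

Lemma levy_maximal_inequality_grid (a h : R) k : 0 <= a -> 0 <= h ->
  (P [set w | exists2 j, (j <= k)%N & (l < expR (g * X (a + j%:R * h) w))%R]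
   <= l^-1%:E * exp_moment X g a)%E.
Proof.
move=> a0 h0; have [X0 _ _ _] := hX.
(* The grid is [0, a, a + h, a + 2 h] and so on: the initial increment carries all of [X a], whose
   moment is the bound, and each later one has length [h] and moment at most [1]. *)
pose t (i : nat) : R := if i is i'.+1 then a + i'%:R * h else 0.
have ndt : nondecreasing_seq t.
  apply/nondecreasing_seqP => -[|i] /=; first by rewrite mul0r addr0.
  by rewrite lerD2l ler_wpM2r// ler_nat.
pose Y i w : R := g * (X (t i.+1) w - X (t i) w).
have mY i : measurable_fun setT (Y i).
  by apply: measurable_funM => //; exact: measurable_funB.
have indY k' n : mutually_independent P (fun i : 'I_n => Y (k' + i)%N).
  move=> B mB; apply: (levy_indep_shift hX k' (lexx _) ndt
    (B := fun i => ( *%R g) @^-1` B i)) => i.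
  have mg : measurable_fun [set: R] ( *%R g) by exact: measurable_funM.
  by rewrite -[X in measurable X]setTI; exact: mg.
have supY i : (\int[P]_w (expR (Y i.+1 w))%:E <= 1)%E.
  have ti0 : 0 <= t i.+1 by exact: (ndt 0%N i.+1 isT).
  rewrite /Y (_ : t i.+2 = t i.+1 + h); last first.
    by rewrite /t -natr1 mulrDl mul1r addrA.
  by rewrite exp_moment_increment// moment_le1.
have := maximal_inequality mY indY (ltW l0) supY k.
have -> : (\int[P]_w (expR (Y 0 w))%:E)%E = exp_moment X g a.
  by apply: eq_integral => w _; rewrite /Y /= mul0r addr0 X0 subr0.
have SY j w : \sum_(i < j.+1) Y i w = g * X (a + j%:R * h) w.
  rewrite /Y -mulr_sumr -(big_mkord predT (fun i => X (t i.+1) w - X (t i) w)).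
  by rewrite telescope_sumr// X0 subr0.
rewrite lee_pdivlMl//; apply: le_trans.
apply: lee_wpmul2l; first by rewrite lee_fin ltW.
by rewrite le_eqVlt; apply/orP; left; apply/eqP; congr (P _);
  apply/seteqP; split => w [j jk]; exists j => //; rewrite ?SY// -SY.
Qed.

(** The event ranges over uncountably many times, so it is enclosed in a measurable set, the limit
    inferior of grid events, instead of being measured itself. *)
Lemma levy_maximal_inequality (a : R) : 0 <= a -> exists S : set T,
  [/\ measurable S, [set w | exists2 s, a <= s & l < expR (g * X s w)] `<=` S &
      (P S <= l^-1%:E * exp_moment X g a)%E].
Proof.
move=> a0; have [X0 _ _ rcX] := hX.
(* With [k.+1 ^ 2] steps of length [1 / k.+1%:R] the mesh shrinks while the horizon [k.+1] grows.
   These grids are not nested, whence the limit inferior. *)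
pose F k := [set w | exists2 j, (j <= k.+1 ^ 2)%N &
  l < expR (g * X (a + j%:R * (1 / k.+1%:R)) w)].
have mF k : measurable (F k).
  rewrite [X in measurable X](_ : _ = \bigcup_(j in `I_(k.+1 ^ 2).+1)
      [set w | l < expR (g * X (a + j%:R * (1 / k.+1%:R)) w)]); last first.
    by apply/seteqP; split => w [j jk lj]; exists j.
  apply: bigcup_measurable => j _.
  rewrite -[X in measurable X]setTI; apply: measurable_fun_ltr => //.
  by apply: measurableT_comp => //; exact: measurable_funM.
pose G m := \bigcap_(k in [set k | (m <= k)%N]) F k.
have mG m : measurable (G m) by apply: bigcap_measurableType => k _.
have ndG : nondecreasing_seq G.
  move=> m n mn; apply/subsetPset => w Gw k /= nk; apply: Gw => /=.
  exact: leq_trans mn nk.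
have mS : measurable (\bigcup_m G m) by exact: bigcup_measurable.
exists (\bigcup_m G m); split => //.
  (* By right continuity, [l < expR (g * X s w)] holds on the [k]-th grid for
     all large [k], at a point just after [s]. *)
  move=> w [s as_ ls].
  have sa0 : 0 <= s - a by rewrite subr_ge0.
  pose q k := a + right_mesh 1 (s - a) k.
  have cq : g * X (q k) w @[k --> \oo] --> g * X s w.
    apply: cvgM; first exact: cvg_cst.
    have [/(_ s (le_trans a0 as_))/cvg_at_rightP + _] := rcX w; apply; split.
      by move=> n; rewrite /q -ltrBlDl right_mesh_gt.
    rewrite -[X in _ --> X](subrKC a); apply: cvgD; first exact: cvg_cst.
    exact: cvg_right_mesh.
  have cE : expR (g * X (q k) w) @[k --> \oo] --> expR (g * X s w).
    apply: (@continuous_cvg _ _ _ _ _ (fun n => g * X (q n) w) expR) => //.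
    exact: continuous_expR.
  have [m _ qm] : \forall k \near \oo, l < expR (g * X (q k) w).
    exact: (cvgr_gt _ cE).
  (* Beyond [m] the level is exceeded at [q k]; beyond the other bound [s - a < k.+1], so [q k] lies
     within the horizon. *)
  exists (maxn m (Num.truncn (s - a)).+1) => // k /=.
  rewrite geq_max => /andP[mk sk].
  exists (Num.truncn ((s - a) * k.+1%:R / 1)).+1; last exact: qm.
  rewrite truncn_lt_nat ?divr1 ?mulr_ge0// natrX expr2 ltr_pM2r//.
  by rewrite -truncn_lt_nat// ltnW.
(* Continuity from below reduces the bound to [G m], which is contained in the single grid event
   [F m]. *)
have cvP := nondecreasing_cvg_mu (mu := P) mG mS ndG.
rewrite -(cvg_lim _ cvP)//; apply: lime_le; first by apply/cvg_ex; eexists; exact: cvP.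
near=> m => /=.
apply: le_trans (levy_maximal_inequality_grid (m.+1 ^ 2) a0 (h := 1 / m.+1%:R) _).
  apply: le_measure; rewrite ?inE; [exact: mG|exact: (mF m)|].
  by move=> w; apply => /=.
by rewrite divr_ge0.
Unshelve. all: by end_near.
Qed.
End levy_maximal_inequality.

(** * The strict gap between a moment and its half exponent *)

Section half_moment.
Context (d : measure_display) (T : measurableType d) (R : realType)
  (P : probability T R).
Variables (Z : T -> R).
Hypothesis mZ : measurable_fun setT Z.
Hypothesis Z2 : (\int[P]_w (expR (2 * Z w))%:E = 1)%E.

(* [(1 - e^Z)^2 + 2 e^Z = 1 + e^(2 Z)] *)
Let half_momentE :
  (\int[P]_w ((1 - expR (Z w)) ^+ 2)%:E + 2%:E * \int[P]_w (expR (Z w))%:E =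
   2%:E)%E.
Proof.
have mE : measurable_fun setT (fun w => expR (Z w)) by exact: measurableT_comp.
have mE2 : measurable_fun setT (fun w => expR (2 * Z w)).
  by apply: measurableT_comp => //; exact: measurable_funM.
have mS : measurable_fun setT (fun w => (1 - expR (Z w)) ^+ 2).
  by apply: measurable_funX; exact: measurable_funB.
have mEE : measurable_fun setT (fun w => (expR (Z w))%:E).
  by apply/measurable_EFinP; exact: mE.
have mEE2 : measurable_fun setT (fun w => (expR (2 * Z w))%:E).
  by apply/measurable_EFinP; exact: mE2.
have mES : measurable_fun setT (fun w => ((1 - expR (Z w)) ^+ 2)%:E).
  by apply/measurable_EFinP; exact: mS.
rewrite -ge0_integralZl ?lee_fin//.
rewrite -ge0_integralD//; first last.
- exact: measurable_funeM.
- by move=> w _; rewrite lee_fin sqr_ge0.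
transitivity (\int[P]_w (1%:E + (expR (2 * Z w))%:E))%E.
  apply: eq_integral => w _; rewrite -EFinM -!EFinD; congr (_%:E).
  by rewrite [in RHS](mulrC 2) expRM_natr; ring.
rewrite ge0_integralD//.
by rewrite Z2 integral_cst//= probability_setT mule1 -EFinD.
Qed.

Lemma half_moment_le1 : (\int[P]_w (expR (Z w))%:E <= 1)%E.
Proof.
have := half_momentE.
have : (0 <= \int[P]_w ((1 - expR (Z w)) ^+ 2)%:E)%E.
  by apply: integral_ge0 => w _; rewrite lee_fin sqr_ge0.
have : (0 <= \int[P]_w (expR (Z w))%:E)%E.
  by apply: integral_ge0 => w _; rewrite lee_fin expR_ge0.
move: (integral _ _ (fun w => (expR (Z w))%:E)) => B B0.
move: (integral _ _ _) => A A0.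
have [->|Bfin] := eqVneq B +oo%E.
  by rewrite mulry gtr0_sg// mul1e addey// gt_eqF// (lt_le_trans _ A0)// ltNyr.
move: A B B0 A0 Bfin => [a||] [b||] //.
rewrite -EFinM -?EFinD ?lee_fin => b0 a0 _ [?]; lra.
Qed.

(** Equality makes the integral of the square in [half_momentE] vanish, so [expR (Z w) = 1] almost
    everywhere. *)
Lemma half_moment_eq1 : (\int[P]_w (expR (Z w))%:E = 1)%E ->
  {ae P, forall w, Z w = 0}.
Proof.
have := half_momentE => /[swap] ->; rewrite mule1.
have : (0 <= \int[P]_w ((1 - expR (Z w)) ^+ 2)%:E)%E.
  by apply: integral_ge0 => w _; rewrite lee_fin sqr_ge0.
move=> A0 A2; have {A2 A0} A0 : (\int[P]_w ((1 - expR (Z w)) ^+ 2)%:E = 0)%E.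
  move: A0 A2; case: (integral _ _ _) => [a||//] //.
  by rewrite -EFinD lee_fin => a0 [a2]; congr (_%:E); lra.
have /(ae_eq_integral_abs P measurableT) : measurable_fun setT
    (fun w => ((1 - expR (Z w)) ^+ 2)%:E).
  apply/measurable_EFinP/measurable_funX/measurable_funB => //.
  exact: measurableT_comp.
case=> + _; case.
  by rewrite -[RHS]A0; apply: eq_integral => w _; rewrite gee0_abs// lee_fin sqr_ge0.
move=> N [mN N0 sN]; exists N; split => // w Zw; apply: sN => /= /(_ I) [] /eqP.
rewrite sqrf_eq0 subr_eq0 eq_sym -expR0 (inj_eq (@expR_inj R)) => /eqP.
exact: Zw.
Qed.
End half_moment.

(** * Almost sure decay and transience *)

Lemma ae_decay (d : measure_display) (T : measurableType d) (R : realType)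
    (P : probability T R) (X : R -> {RV P >-> R}) (g h l : R) :
  levy_process X -> (forall s, 0 <= s -> (exp_moment X g s <= 1)%E) ->
  0 < h -> (exp_moment X g h < 1)%E -> 0 < l ->
  {ae P, forall w, exists s0, forall s, s0 <= s -> expR (g * X s w) <= l}.
Proof.
move=> hX mle1 h0 mh1 l0.
have nh0 n : 0 <= n%:R * h by rewrite mulr_ge0// ltW.
have /choice[S SP] n := levy_maximal_inequality hX l0 mle1 (nh0 n).
(* A path violating the conclusion exceeds [l] after every time [n%:R * h], hence lies in all the
   [S n], whose probabilities are at most [l^-1 * r ^+ n]. *)
have mS : measurable (\bigcap_n S n).
  by apply: bigcap_measurableType => n _; have [] := SP n.
exists (\bigcap_n S n); split => //; last first.
  move=> w /= Hw n _; have [_ subS _] := SP n; apply: subS => /=.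
  apply: contrapT => Hn; apply: Hw; exists (n%:R * h) => s ns.
  by rewrite leNgt; apply/negP => ls; apply: Hn; exists s.
have := exp_moment_ge0 X g h; move: mh1.
case mE : (exp_moment X g h) => [r||//]; rewrite ?lte_fin ?lee_fin => r1 r0 //.
have cr : (l^-1 * r ^+ n)%:E @[n --> \oo] --> (0 : \bar R).
  apply: cvg_EFin; first by near=> n.
  rewrite -[X in _ --> X](mulr0 l^-1); apply: cvgM; first exact: cvg_cst.
  by apply: cvg_expr; rewrite ger0_norm.
apply/eqP; rewrite eq_le measure_ge0 andbT -(cvg_lim _ cr)//.
apply: lime_ge; first by apply/cvg_ex; eexists; exact: cr.
near=> n; have [mSn _] := SP n.
rewrite (exp_momentMn hX g n (ltW h0)) mE -EFin_expe -EFinM; apply: le_trans.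
by apply: le_measure; rewrite ?inE// => w; apply.
Unshelve. all: by end_near.
Qed.

(** The null sets at positive rational times are countably many; off their union, right continuity
    treats all times at once. *)
Lemma zero_process_of_ae0 (d : measure_display) (T : measurableType d)
    (R : realType) (P : probability T R) (X : R -> {RV P >-> R}) :
  levy_process X -> (forall h, 0 < h -> {ae P, forall w, X h w = 0}) ->
  zero_process X.
Proof.
move=> [_ _ _ rcX] X0.
have : {ae P, forall w, forall j n, X (j.+1%:R * (1 / n.+1%:R)) w = 0}.
  by apply: ae_foralln => j; apply: ae_foralln => n; exact: X0.
apply: filterS => w Xw t t0.
have cX : X (right_mesh 1 t n) w @[n --> \oo] --> X t w.
  have [/(_ t t0)/cvg_at_rightP + _] := rcX w; apply; split.
    by move=> n; exact: right_mesh_gt.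
  exact: cvg_right_mesh.
have c0 : X (right_mesh 1 t n) w @[n --> \oo] --> (0 : R).
  have -> : (fun n => X (right_mesh 1 t n) w) = cst 0 by apply/funext => n; exact: Xw.
  exact: cvg_cst.
exact: (cvg_unique (@Rhausdorff R) cX c0).
Qed.

(** With [Z = b / 2 * X s], the mean of [expR (2 * Z)] is [1]. Were no half moment strictly below
    [1], every [X h] with [0 < h] would vanish almost surely. *)
Lemma strict_half_moment (d : measure_display) (T : measurableType d)
    (R : realType) (P : probability T R) (X : R -> {RV P >-> R}) (b : R) :
  levy_process X -> ~ zero_process X -> b != 0 ->
  (forall s, 0 <= s -> exp_moment X b s = 1%E) ->
  (forall s, 0 <= s -> (exp_moment X (b / 2) s <= 1)%E) /\
  (exists2 h, 0 < h & (exp_moment X (b / 2) h < 1)%E).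
Proof.
move=> hX nzX b0 m1.
have mZ s : measurable_fun setT (fun w => b / 2 * X s w).
  exact: measurable_funM.
have Z2 s : 0 <= s -> (\int[P]_w (expR (2 * (b / 2 * X s w)))%:E = 1)%E.
  move=> s0; rewrite -[RHS](m1 s s0); apply: eq_integral => w _.
  by congr (expR _)%:E; field.
have le1 s : 0 <= s -> (exp_moment X (b / 2) s <= 1)%E.
  by move=> s0; exact: half_moment_le1 (mZ s) (Z2 s s0).
split => //; apply: contrapT => nlt1; apply: nzX; apply: zero_process_of_ae0 => //.
move=> h h0; have eq1 : exp_moment X (b / 2) h = 1%E.
  apply/eqP; rewrite eq_le (le1 _ (ltW h0)) andTb leNgt; apply/negP => lt1.
  by apply: nlt1; exists h.
have := half_moment_eq1 (mZ h) (Z2 h (ltW h0)) eq1; apply: filterS => w /eqP.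
by rewrite mulf_eq0 (negbTE (mulf_neq0 b0 _)) ?invr_eq0//= => /eqP.
Qed.

(** The zero process is set apart in the second claim: every exponent is a unit exponent for it, yet
    it stays at [0]. *)
Theorem corollary17 (d : measure_display) (T : measurableType d)
    (R : realType) (P : probability T R) (X : R -> {RV P >-> R})
    (hX : levy_process X) (t : R) (ht : 0 < t) :
  (forall s : R, 0 < s -> unit_exponents X s = unit_exponents X t) /\
  (~ zero_process X -> unit_exponents X t `\ 0 !=set0 -> transient X).
Proof.
have unitE b s : unit_exponents X s b <-> exp_moment X b s = 1%E.
  by rewrite /unit_exponents /= unlock.
split=> [s s0|nzX [b [/unitE mt1 /eqP b0]]].
  by apply/seteqP; split => b /unitE m1; apply/unitE;
    apply: (exp_moment_unit hX _ m1) => //; exact: ltW.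
have [le1 [h h0 lt1]] := strict_half_moment hX nzX b0
  (fun s => exp_moment_unit hX ht mt1 (s := s)).
(* The countable family of levels [expR (- n%:R)] keeps the exceptional set null while forcing
   [b / 2 * X s w] to [-oo]. *)
have ae_small : {ae P, forall w, forall n : nat, exists s0, forall s, s0 <= s ->
    expR (b / 2 * X s w) <= expR (- n%:R)}.
  by apply: ae_foralln => n; apply: (ae_decay hX le1 h0 lt1); exact: expR_gt0.
apply: filterS ae_small => w small; apply/cvgryPge => A.
have c0 : 0 < `|b / 2| by rewrite normr_gt0 mulf_neq0// invr_eq0.
(* An integer above [|b / 2| * A], so that dividing by [|b / 2|] leaves at least [A]. *)
have [s0 Hs0] := small (Num.truncn (`|b / 2| * A)).+1.
near=> s; have : s0 <= s by near: s; by apply: nbhs_pinfty_ge; exact: num_real.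
move=> /Hs0; rewrite ler_expR => bXs.
rewrite -(ler_pM2l c0) -normrM ler_normr.
by apply/orP; right; rewrite lerNr (le_trans bXs)// lerN2 ltW// truncnS_gt.
Unshelve. all: by end_near.
Qed.
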